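(* Let $\mathbb{A}$ be a 2-category and $p:e\to b$ a 1-cell such that $\mathbb{A}$ has the two-dimensional cokernel diagram of $p$, a right Kan extension $(t,\gamma)$ of $p$ along $p$ exists, and it is preserved by $\delta^0:b\to b\uparrow_pb$. Let $\mathsf{T}=(b,t,m,\eta)$ be the codensity monad of $p$. For each object $x$ consider the factorizations $$\mathbb{A}(x,p)=U^{H}_x\circ K^{H}_x:\ \mathbb{A}(x,e)\to \mathrm{Desc}_p(x)\to\mathbb{A}(x,b),\qquad \mathbb{A}(x,p)=U^{\mathsf{T}}_x\circ K^{\mathsf{T}}_x:\ \mathbb{A}(x,e)\to \mathrm{Alg}_{\mathsf{T}}(x)\to\mathbb{A}(x,b),$$ where $K^H_x(g)=(pg,\alpha\ast\mathrm{id}_g)$, $K^H_x(\chi)=\mathrm{id}_p\ast\chi$, $K^{\mathsf{T}}_x(g)=(pg,\gamma\ast\mathrm{id}_g)$, $K^{\mathsf{T}}_x(\chi)=\mathrm{id}_p\ast\chi$, and $U^H_x$, $U^{\mathsf{T}}_x$ are the forgetful functors $(h,\beta)\mapsto h$, $\xi\mapsto\xi$. Then these two factorizations are isomorphic, 2-naturally in $x$: there are isomorphisms of categories $\Phi_x:\mathrm{Desc}_p(x)\to\mathrm{Alg}_{\mathsf{T}}(x)$, 2-natural in $x$ (with respect to precomposition by 1-cells and 2-cells $x'\to x$), such that $U^{\mathsf{T}}_x\Phi_x=U^H_x$ and $\Phi_xK^H_x=K^{\mathsf{T}}_x$.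
   Context: A 2-category is a $\mathbf{Cat}$-enriched category; composition of 1-cells is juxtaposition, vertical composition of 2-cells is $\cdot$, horizontal composition is $\ast$, $\mathrm{id}_f$ is the identity 2-cell on $f$; $\mathbb{A}(x,y)$ is the hom-category. Opcomma object of $p$ along itself: an object $b\uparrow_p b$ with 1-cells $\delta^0,\delta^1:b\to b\uparrow_p b$ and a 2-cell $\alpha:\delta^1p\Rightarrow\delta^0p$ such that for every object $y$ the functor $h\mapsto(h\delta^0,h\delta^1,\mathrm{id}_h\ast\alpha)$, $\xi\mapsto(\xi\ast\mathrm{id}_{\delta^0},\xi\ast\mathrm{id}_{\delta^1})$ is an isomorphism from $\mathbb{A}(b\uparrow_p b,y)$ onto the category of triples $(h_0,h_1:b\to y,\ \beta:h_1p\Rightarrow h_0p)$ with morphisms pairs of 2-cells $(\xi_0:h_0\Rightarrow h_0',\xi_1:h_1\Rightarrow h_1')$ satisfying $(\xi_0\ast\mathrm{id}_p)\cdot\beta=\beta'\cdot(\xi_1\ast\mathrm{id}_p)$. Two-dimensional pushout of a span $f_0:c\to c_0$, $f_1:c\to c_1$: an object $P$ with $q_0:c_0\to P$, $q_1:c_1\to P$, $q_0f_0=q_1f_1$, such that for every $y$, $k\mapsto(kq_0,kq_1)$ is an isomorphism from $\mathbb{A}(P,y)$ onto the category of pairs $(k_0,k_1)$ with $k_0f_0=k_1f_1$, whose morphisms are pairs of 2-cells $(\xi_0,\xi_1)$ with $\xi_0\ast\mathrm{id}_{f_0}=\xi_1\ast\mathrm{id}_{f_1}$. $\mathbb{A}$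 has the two-dimensional cokernel diagram of $p$ if it has an opcomma object $b\uparrow_p b$ of $p$ along itself and a two-dimensional pushout $b\uparrow_pb\uparrow_pb$ of the span $(\delta^0,\delta^1)$, with 1-cells $D^0,D^2$ satisfying $D^2\delta^0=D^0\delta^1$. Then $D^1$ is the unique 1-cell with $D^1\delta^1=D^2\delta^1$, $D^1\delta^0=D^0\delta^0$, $\mathrm{id}_{D^1}\ast\alpha=(\mathrm{id}_{D^0}\ast\alpha)\cdot(\mathrm{id}_{D^2}\ast\alpha)$, and $s^0:b\uparrow_pb\to b$ is the unique 1-cell with $s^0\delta^0=s^0\delta^1=\mathrm{id}_b$, $\mathrm{id}_{s^0}\ast\alpha=\mathrm{id}_p$. $\mathrm{Desc}_p(x)$ (the lax descent category of $\mathbb{A}(x,-)$ applied to the two-dimensional cokernel diagram of $p$): objects are pairs $(h:x\to b,\ \beta:\delta^1h\Rightarrow\delta^0h)$ with $(\mathrm{id}_{D^0}\ast\beta)\cdot(\mathrm{id}_{D^2}\ast\beta)=\mathrm{id}_{D^1}\ast\beta$ and $\mathrm{id}_{s^0}\ast\beta=\mathrm{id}_h$; morphisms $(h_1,\beta_1)\to(h_0,\beta_0)$ are 2-cells $\xi:h_1\Rightarrow h_0$ with $\beta_0\cdot(\mathrm{id}_{\delta^1}\ast\xi)=(\mathrm{id}_{\delta^0}\ast\xi)\cdot\beta_1$. Right Kan extension of $f:z\to y$ along $g:z\to w$: a pair $(r:w\to y,\gamma:rg\Rightarrow f)$ such that for each $k:w\to y$, $\beta\mapsto\gamma\cdot(\beta\ast\mathrm{id}_g)$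 is a bijection from 2-cells $k\Rightarrow r$ to 2-cells $kg\Rightarrow f$; a 1-cell $d$ preserves it if $(dr,\mathrm{id}_d\ast\gamma)$ is a right Kan extension of $df$ along $g$. Codensity monad $\mathsf{T}=(b,t,m,\eta)$ of $p$: $(t,\gamma)$ a right Kan extension of $p$ along $p$, $m:tt\Rightarrow t$ unique with $\gamma\cdot(m\ast\mathrm{id}_p)=\gamma\cdot(\mathrm{id}_t\ast\gamma)$, $\eta:\mathrm{id}_b\Rightarrow t$ unique with $\gamma\cdot(\eta\ast\mathrm{id}_p)=\mathrm{id}_p$. $\mathrm{Alg}_{\mathsf{T}}(x)$ (Eilenberg–Moore category of the monad $\mathbb{A}(x,\mathsf{T})$ on $\mathbb{A}(x,b)$): objects are pairs $(h:x\to b,\ \beta:th\Rightarrow h)$ with $\beta\cdot(\mathrm{id}_t\ast\beta)=\beta\cdot(m\ast\mathrm{id}_h)$ and $\beta\cdot(\eta\ast\mathrm{id}_h)=\mathrm{id}_h$; morphisms $(h_1,\beta_1)\to(h_0,\beta_0)$ are 2-cells $\xi:h_1\Rightarrow h_0$ with $\xi\cdot\beta_1=\beta_0\cdot(\mathrm{id}_t\ast\xi)$. *)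

(* Defs.v *)
Record TwoCat : Type := {
  Ob : Type;
  C1 : Ob -> Ob -> Type;
  C2 : Ob -> Ob -> Type;
  src : forall {x y : Ob}, C2 x y -> C1 x y;
  tgt : forall {x y : Ob}, C2 x y -> C1 x y;
  id1 : forall x : Ob, C1 x x;
  comp1 : forall {x y z : Ob}, C1 y z -> C1 x y -> C1 x z;
  id2 : forall {x y : Ob}, C1 x y -> C2 x y;
  (* vcomp b a = b . a  ("a first, then b") *)
  vcomp : forall {x y : Ob}, C2 x y -> C2 x y -> C2 x y;
  hcomp : forall {x y z : Ob}, C2 y z -> C2 x y -> C2 x z;

  comp1_assoc : forall w x y z (f : C1 y z) (g : C1 x y) (h : C1 w x),
      comp1 (comp1 f g) h = comp1 f (comp1 g h);
  comp1_idl : forall x y (f : C1 x y), comp1 (id1 y) f = f;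
  comp1_idr : forall x y (f : C1 x y), comp1 f (id1 x) = f;
  src_id2 : forall x y (f : C1 x y), src (id2 f) = f;
  tgt_id2 : forall x y (f : C1 x y), tgt (id2 f) = f;
  src_vcomp : forall x y (a b : C2 x y), tgt a = src b -> src (vcomp b a) = src a;
  tgt_vcomp : forall x y (a b : C2 x y), tgt a = src b -> tgt (vcomp b a) = tgt b;
  src_hcomp : forall x y z (a : C2 y z) (b : C2 x y),
      src (hcomp a b) = comp1 (src a) (src b);
  tgt_hcomp : forall x y z (a : C2 y z) (b : C2 x y),
      tgt (hcomp a b) = comp1 (tgt a) (tgt b);
  vcomp_assoc : forall x y (a b c : C2 x y), tgt a = src b -> tgt b = src c ->
      vcomp c (vcomp b a) = vcomp (vcomp c b) a;
  vcomp_idl : forall x y (a : C2 x y), vcomp (id2 (tgt a)) a = a;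
  vcomp_idr : forall x y (a : C2 x y), vcomp a (id2 (src a)) = a;
  hcomp_assoc : forall w x y z (a : C2 y z) (b : C2 x y) (c : C2 w x),
      hcomp (hcomp a b) c = hcomp a (hcomp b c);
  hcomp_idl : forall x y (a : C2 x y), hcomp (id2 (id1 y)) a = a;
  hcomp_idr : forall x y (a : C2 x y), hcomp a (id2 (id1 x)) = a;
  hcomp_id2 : forall x y z (f : C1 y z) (g : C1 x y),
      hcomp (id2 f) (id2 g) = id2 (comp1 f g);
  interchange : forall x y z (a a' : C2 y z) (b b' : C2 x y),
      tgt a = src a' -> tgt b = src b' ->
      hcomp (vcomp a' a) (vcomp b' b) = vcomp (hcomp a' b') (hcomp a b)
}.


Arguments C1 {t} x y.
Arguments C2 {t} x y.
Arguments src {t x y} _.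
Arguments tgt {t x y} _.
Arguments id1 {t} x.
Arguments comp1 {t x y z} _ _.
Arguments id2 {t x y} _.
Arguments vcomp {t x y} _ _.
Arguments hcomp {t x y z} _ _.

Section TwoCatDefs.
Context {A : TwoCat}.

Definition is2 {x y : Ob A} (a : C2 x y) (f g : C1 x y) : Prop :=
  src a = f /\ tgt a = g.

(* Opcomma object (c, d0, d1, al) of p along itself; the isomorphism of
   categories A(c,y) ~= triples is stated as bijectivity on objects and on
   morphisms of the functor h |-> (h d0, h d1, id_h * al). *)
Definition is_opcomma {e b : Ob A} (p : C1 e b) (c : Ob A) (d0 d1 : C1 b c)
    (al : C2 e c) : Prop :=
  is2 al (comp1 d1 p) (comp1 d0 p) /\
  (forall (y : Ob A) (h0 h1 : C1 b y) (be : C2 e y),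
      is2 be (comp1 h1 p) (comp1 h0 p) ->
      exists! h : C1 c y,
        comp1 h d0 = h0 /\ comp1 h d1 = h1 /\ hcomp (id2 h) al = be) /\
  (forall (y : Ob A) (h h' : C1 c y) (x0 x1 : C2 b y),
      is2 x0 (comp1 h d0) (comp1 h' d0) ->
      is2 x1 (comp1 h d1) (comp1 h' d1) ->
      vcomp (hcomp x0 (id2 p)) (hcomp (id2 h) al)
        = vcomp (hcomp (id2 h') al) (hcomp x1 (id2 p)) ->
      exists! xi : C2 c y,
        is2 xi h h' /\ hcomp xi (id2 d0) = x0 /\ hcomp xi (id2 d1) = x1).

Definition is_pushout2 {c c0 c1 : Ob A} (f0 : C1 c c0) (f1 : C1 c c1)
    (P : Ob A) (q0 : C1 c0 P) (q1 : C1 c1 P) : Prop :=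
  comp1 q0 f0 = comp1 q1 f1 /\
  (forall (y : Ob A) (k0 : C1 c0 y) (k1 : C1 c1 y),
      comp1 k0 f0 = comp1 k1 f1 ->
      exists! k : C1 P y, comp1 k q0 = k0 /\ comp1 k q1 = k1) /\
  (forall (y : Ob A) (k k' : C1 P y) (x0 : C2 c0 y) (x1 : C2 c1 y),
      is2 x0 (comp1 k q0) (comp1 k' q0) ->
      is2 x1 (comp1 k q1) (comp1 k' q1) ->
      hcomp x0 (id2 f0) = hcomp x1 (id2 f1) ->
      exists! xi : C2 P y,
        is2 xi k k' /\ hcomp xi (id2 q0) = x0 /\ hcomp xi (id2 q1) = x1).

Definition is_ran {z y w : Ob A} (f : C1 z y) (g : C1 z w) (r : C1 w y)
    (ga : C2 z y) : Prop :=
  is2 ga (comp1 r g) f /\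
  (forall (k : C1 w y) (s : C2 z y), is2 s (comp1 k g) f ->
      exists! be : C2 w y, is2 be k r /\ vcomp ga (hcomp be (id2 g)) = s).

Definition is_D1 {e b c P : Ob A} (p : C1 e b) (d0 d1 : C1 b c) (al : C2 e c)
    (D0 D1 D2 : C1 c P) : Prop :=
  comp1 D1 d1 = comp1 D2 d1 /\ comp1 D1 d0 = comp1 D0 d0 /\
  hcomp (id2 D1) al = vcomp (hcomp (id2 D0) al) (hcomp (id2 D2) al).

Definition is_s0 {e b c : Ob A} (p : C1 e b) (d0 d1 : C1 b c) (al : C2 e c)
    (s0 : C1 c b) : Prop :=
  comp1 s0 d0 = id1 b /\ comp1 s0 d1 = id1 b /\ hcomp (id2 s0) al = id2 p.

Definition IsDesc {b c P : Ob A} (d0 d1 : C1 b c) (D0 D1 D2 : C1 c P)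
    (s0 : C1 c b) {x : Ob A} (h : C1 x b) (be : C2 x c) : Prop :=
  is2 be (comp1 d1 h) (comp1 d0 h) /\
  vcomp (hcomp (id2 D0) be) (hcomp (id2 D2) be) = hcomp (id2 D1) be /\
  hcomp (id2 s0) be = id2 h.

Definition DescHom {b c : Ob A} (d0 d1 : C1 b c) {x : Ob A}
    (h1 : C1 x b) (be1 : C2 x c) (h0 : C1 x b) (be0 : C2 x c) (xi : C2 x b)
    : Prop :=
  is2 xi h1 h0 /\
  vcomp be0 (hcomp (id2 d1) xi) = vcomp (hcomp (id2 d0) xi) be1.

Definition IsAlg {b : Ob A} (t : C1 b b) (m eta : C2 b b) {x : Ob A}
    (h : C1 x b) (be : C2 x b) : Prop :=
  is2 be (comp1 t h) h /\
  vcomp be (hcomp (id2 t) be) = vcomp be (hcomp m (id2 h)) /\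
  vcomp be (hcomp eta (id2 h)) = id2 h.

Definition AlgHom {b : Ob A} (t : C1 b b) {x : Ob A}
    (h1 : C1 x b) (be1 : C2 x b) (h0 : C1 x b) (be0 : C2 x b) (xi : C2 x b)
    : Prop :=
  is2 xi h1 h0 /\ vcomp xi be1 = vcomp be0 (hcomp (id2 t) xi).

End TwoCatDefs.

(* Main.v *)
Require Import Defs.

(* The 2-cell ga : t p => p induces l : c -> b with l d0 = id, l d1 = t and
   l al = ga.  Since d0 preserves the Kan extension, al = (d0 ga) . (rho p) for
   a unique rho : d1 => d0 t, and rho is the d1-component of the unit of an
   adjunction l -| d0 with identity counit.  Hence be |-> l be is a bijection
   from 2-cells d1 h => d0 h to 2-cells t h => h, with inverse
   be' |-> (d0 be') . (rho h); this is Phi.  The unit laws correspond because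
   s0 rho = eta.  For the multiplication, the pushout gives L : P -> b with
   L D0 = l and L D2 = t l, again left adjoint, to D0 d0, with identity counit;
   transposing along it yields D1 rho = (D0 d0 m) . (D0 rho t) . (D2 rho), and
   applying L turns the cocycle condition into associativity. *)

Lemma comp1_reassoc {A : TwoCat} {x y z : Ob A} {f : C1 y z} {g : C1 x y}
    {k : C1 x z} :
  comp1 f g = k ->
  forall (w : Ob A) (h : C1 w x), comp1 f (comp1 g h) = comp1 k h.
Proof. intros <- w h; symmetry; apply comp1_assoc. Qed.

Ltac norm1 :=
  repeat first
    [ rewrite comp1_assoc | rewrite comp1_idl | rewrite comp1_idr
    | match goal with H : comp1 _ _ = _ |- _ => rewrite H end
    | match goal with H : comp1 _ _ = _ |- _ => rewrite (comp1_reassoc H) end ].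

(** 2-cells carry their boundaries as data, so each interchange or whiskering step leaves equations
    between sources and targets; these reduce to equations between reassociated 1-cells. *)
Ltac ty :=
  unfold is2 in *;
  repeat match goal with H : _ /\ _ |- _ => destruct H end;
  repeat split;
  repeat first
    [ rewrite src_id2 | rewrite tgt_id2 | rewrite src_hcomp | rewrite tgt_hcomp
    | match goal with
      | H : src ?a = _ |- context [src ?a] => rewrite H
      | H : tgt ?a = _ |- context [tgt ?a] => rewrite H
      end
    | rewrite src_vcomp by ty | rewrite tgt_vcomp by ty ];
  norm1; solve [reflexivity | congruence].

Section Whiskering.
Context {A : TwoCat}.

Lemma vcomp_id_l {x y : Ob A} (a : C2 x y) (g : C1 x y) :
  tgt a = g -> vcomp (id2 g) a = a.
Proof. intros <-; apply vcomp_idl. Qed.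

Lemma vcomp_id_r {x y : Ob A} (a : C2 x y) (f : C1 x y) :
  src a = f -> vcomp a (id2 f) = a.
Proof. intros <-; apply vcomp_idr. Qed.

Lemma whisker_l_vcomp {x y z : Ob A} (f : C1 y z) (a b : C2 x y) :
  tgt a = src b ->
  hcomp (id2 f) (vcomp b a) = vcomp (hcomp (id2 f) b) (hcomp (id2 f) a).
Proof.
  intros H. rewrite <- interchange, (vcomp_id_r (id2 f) f) by ty. reflexivity.
Qed.

Lemma whisker_r_vcomp {x y z : Ob A} (a b : C2 y z) (f : C1 x y) :
  tgt a = src b ->
  hcomp (vcomp b a) (id2 f) = vcomp (hcomp b (id2 f)) (hcomp a (id2 f)).
Proof.
  intros H. rewrite <- interchange, (vcomp_id_r (id2 f) f) by ty. reflexivity.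
Qed.

Lemma whisker_l_comp {w x y z : Ob A} (f : C1 y z) (g : C1 x y) (a : C2 w x) :
  hcomp (id2 f) (hcomp (id2 g) a) = hcomp (id2 (comp1 f g)) a.
Proof. rewrite <- hcomp_assoc, hcomp_id2; reflexivity. Qed.

Lemma whisker_r_comp {w x y z : Ob A} (a : C2 y z) (f : C1 x y) (g : C1 w x) :
  hcomp (hcomp a (id2 f)) (id2 g) = hcomp a (id2 (comp1 f g)).
Proof. rewrite hcomp_assoc, hcomp_id2; reflexivity. Qed.

Lemma whisker_exchange {x y z : Ob A} (a : C2 y z) (f f' : C1 y z)
    (b : C2 x y) (g g' : C1 x y) :
  is2 a f f' -> is2 b g g' ->
  vcomp (hcomp a (id2 g')) (hcomp (id2 f) b)
  = vcomp (hcomp (id2 f') b) (hcomp a (id2 g)).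
Proof.
  intros Ha Hb.
  rewrite <- !interchange by ty.
  rewrite !vcomp_id_l, !vcomp_id_r by ty. reflexivity.
Qed.

(* [l] is left adjoint to [d] with unit [u] and identity counit. *)
Lemma reflection_transpose {b c : Ob A} {l : C1 c b} {d : C1 b c} {u : C2 c c} :
  is2 u (id1 c) (comp1 d l) -> hcomp u (id2 d) = id2 d ->
  forall (x : Ob A) (f : C1 x c) (k : C1 x b) (th : C2 x c),
    is2 th f (comp1 d k) ->
    th = vcomp (hcomp (id2 d) (hcomp (id2 l) th)) (hcomp u (id2 f)).
Proof.
  intros Hu Hud x f k th Hth.
  rewrite whisker_l_comp, <- (whisker_exchange u (id1 c) _ th f _ Hu Hth).
  rewrite <- whisker_r_comp, Hud, hcomp_idl, hcomp_id2.
  symmetry; apply vcomp_id_l; ty.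
Qed.

Lemma ran_ext {z y w : Ob A} {f : C1 z y} {g : C1 z w} {r : C1 w y}
    {ga : C2 z y} (H : is_ran f g r ga) (k : C1 w y) (a a' : C2 w y) :
  is2 a k r -> is2 a' k r ->
  vcomp ga (hcomp a (id2 g)) = vcomp ga (hcomp a' (id2 g)) -> a = a'.
Proof.
  intros Ha Ha' E. destruct H as [Hga H].
  destruct (H k (vcomp ga (hcomp a (id2 g)))) as [be [_ U]]; [ty|].
  rewrite <- (U a), <- (U a'); auto.
Qed.

End Whiskering.

Theorem theorem4p7 (A : TwoCat) (e b : Ob A) (p : C1 e b)
    (* opcomma object b up_p b *)
    (c : Ob A) (d0 d1 : C1 b c) (al : C2 e c)
    (Hop : is_opcomma p c d0 d1 al)
    (* two-dimensional pushout b up_p b up_p b of (d0, d1), with D2 d0 = D0 d1 *)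
    (P : Ob A) (D0 D2 : C1 c P)
    (Hpo : is_pushout2 d0 d1 P D2 D0)
    (D1 : C1 c P) (HD1 : is_D1 p d0 d1 al D0 D1 D2)
    (s0 : C1 c b) (Hs0 : is_s0 p d0 d1 al s0)
    (* right Kan extension of p along p, preserved by d0 *)
    (t : C1 b b) (ga : C2 e b) (Hran : is_ran p p t ga)
    (Hpres : is_ran (comp1 d0 p) p (comp1 d0 t) (hcomp (id2 d0) ga))
    (* codensity monad *)
    (m : C2 b b)
    (Hm : is2 m (comp1 t t) t /\
          vcomp ga (hcomp m (id2 p)) = vcomp ga (hcomp (id2 t) ga))
    (eta : C2 b b)
    (Heta : is2 eta (id1 b) t /\ vcomp ga (hcomp eta (id2 p)) = id2 p) :
  (* Phi x : Desc_p(x) -> Alg_T(x); U^T Phi_x = U^H_x forces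
     Phi_x (h, be) = (h, Phi x h be) and Phi_x xi = xi. *)
  exists Phi : forall x : Ob A, C1 x b -> C2 x c -> C2 x b,
    (* well defined on objects *)
    (forall x (h : C1 x b) (be : C2 x c),
        IsDesc d0 d1 D0 D1 D2 s0 h be -> IsAlg t m eta h (Phi x h be)) /\
    (* bijective on objects *)
    (forall x (h : C1 x b) (be' : C2 x b),
        IsAlg t m eta h be' ->
        exists! be : C2 x c, IsDesc d0 d1 D0 D1 D2 s0 h be /\ Phi x h be = be') /\
    (* functorial, and bijective on morphisms *)
    (forall x (h1 : C1 x b) (be1 : C2 x c) (h0 : C1 x b) (be0 : C2 x c)
            (xi : C2 x b),
        IsDesc d0 d1 D0 D1 D2 s0 h1 be1 -> IsDesc d0 d1 D0 D1 D2 s0 h0 be0 ->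
        (DescHom d0 d1 h1 be1 h0 be0 xi <->
         AlgHom t h1 (Phi x h1 be1) h0 (Phi x h0 be0) xi)) /\
    (* Phi_x K^H_x = K^T_x *)
    (forall x (g : C1 x e),
        Phi x (comp1 p g) (hcomp al (id2 g)) = hcomp ga (id2 g)) /\
    (* 2-naturality w.r.t. precomposition by 1-cells u : x' -> x *)
    (forall x x' (u : C1 x' x) (h : C1 x b) (be : C2 x c),
        IsDesc d0 d1 D0 D1 D2 s0 h be ->
        Phi x' (comp1 h u) (hcomp be (id2 u)) = hcomp (Phi x h be) (id2 u)).
Proof.
  destruct Hop as (Hal & Hop1 & Hop2).
  destruct Hpo as (HP & Hpo1 & Hpo2).
  destruct HD1 as (HD11 & HD10 & HD1al).
  destruct Hs0 as (Hs00 & Hs01 & Hs0al).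
  destruct Hm as [Hm Hmga].
  destruct Heta as [Heta Hetaga].
  assert (Hga : is2 ga (comp1 t p) p) by apply Hran.
  destruct (Hop1 b (id1 b) t ga) as (l & (Hl0 & Hl1 & Hlal) & _); [ty|].
  destruct (proj2 Hpres d1 al) as (rho & (Hrho & Hrhoga) & _); [ty|].
  (* Compatibility of the two components of the unit [u] with [al] is the defining equation of
     [rho], because [l] sends [al] to [ga]. *)
  destruct (Hop2 c (id1 c) (comp1 d0 l) (id2 d0) rho)
    as (u & (Hu & Hud0 & Hud1) & _); [ty | ty | |].
  { rewrite hcomp_idl, hcomp_id2, vcomp_id_l by ty.
    rewrite <- whisker_l_comp, Hlal. symmetry; exact Hrhoga. }
  (* A retraction [k] of [d0] cancels [d0] in [(d0 ga) . (rho p) = al], so the Kan extension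
     determines [k rho] from [k al]. Taking [l], [s0] and [L D1] for [k] yields [id2 t], [eta] and
     [m]. *)
  assert (Hrho_k : forall k : C1 c b, comp1 k d0 = id1 b ->
            vcomp ga (hcomp (hcomp (id2 k) rho) (id2 p)) = hcomp (id2 k) al).
  { intros k Hk. rewrite <- Hrhoga, whisker_l_vcomp by ty.
    rewrite whisker_l_comp, Hk, hcomp_idl, hcomp_assoc. reflexivity. }
  assert (Hlrho : hcomp (id2 l) rho = id2 t).
  { apply (ran_ext Hran t); [ty | ty |].
    rewrite Hrho_k, Hlal, hcomp_id2, vcomp_id_r by ty. reflexivity. }
  assert (Hs0rho : hcomp (id2 s0) rho = eta).
  { apply (ran_ext Hran (id1 b)); [ty | ty |].
    rewrite Hrho_k by exact Hs00. congruence. }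
  destruct (Hpo1 b (comp1 t l) l) as (L & (HL2 & HL0) & _); [ty|].
  (* The [D2]-component of the unit [v] is the path [D2 => D2 d0 l = D0 d1 l => D0 d0 t l]. Along
     [d0] its first leg is an identity, so it agrees with [D0 u] along [d1]. *)
  destruct (Hpo2 P (id1 P) (comp1 (comp1 D0 d0) L)
              (vcomp (hcomp (hcomp (id2 D0) rho) (id2 l)) (hcomp (id2 D2) u))
              (hcomp (id2 D0) u)) as (v & (Hv & Hv2 & Hv0) & _); [ty | ty | |].
  { rewrite whisker_r_vcomp by ty.
    rewrite whisker_r_comp, Hl0, hcomp_idr, hcomp_assoc, Hud0, hcomp_id2,
      vcomp_id_r, hcomp_assoc, Hud1 by ty. reflexivity. }
  assert (Hvd : hcomp v (id2 (comp1 D0 d0)) = id2 (comp1 D0 d0)).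
  { rewrite <- whisker_r_comp, Hv0, hcomp_assoc, Hud0. apply hcomp_id2. }
  set (sg := vcomp (hcomp (hcomp (id2 D0) rho) (id2 t)) (hcomp (id2 D2) rho)).
  assert (Hsg : is2 sg (comp1 D2 d1) (comp1 (comp1 D0 d0) (comp1 t t)))
    by (unfold sg; ty).
  assert (Hvsg : hcomp v (id2 (comp1 D2 d1)) = sg).
  { rewrite <- whisker_r_comp, Hv2, whisker_r_vcomp, whisker_r_comp by ty.
    rewrite Hl1, (hcomp_assoc _ _ _ _ _ (id2 D2)), Hud1. reflexivity. }
  assert (HLsg : hcomp (id2 L) sg = id2 (comp1 t t)).
  { unfold sg. rewrite whisker_l_vcomp by ty.
    rewrite <- hcomp_assoc, !whisker_l_comp, HL0, HL2, Hlrho.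
    rewrite <- whisker_l_comp, Hlrho, hcomp_id2.
    apply vcomp_id_l; ty. }
  assert (HD1rho : hcomp (id2 D1) rho
                   = vcomp (hcomp (id2 (comp1 D0 d0)) m) sg).
  { assert (HLm : hcomp (id2 (comp1 L D1)) rho = m).
    { apply (ran_ext Hran (comp1 t t)); [ty | ty |].
      rewrite Hrho_k, Hmga by ty.
      rewrite <- whisker_l_comp, HD1al, whisker_l_vcomp by ty.
      rewrite !whisker_l_comp, HL0, HL2, Hlal, <- whisker_l_comp, Hlal.
      reflexivity. }
    rewrite (reflection_transpose Hv Hvd _ (comp1 D2 d1) t
               (hcomp (id2 D1) rho)) by ty.
    rewrite (whisker_l_comp L D1), HLm, Hvsg. reflexivity. }
  (* Two 1-cells [h] and [k] are allowed because the two sides of a morphism equation run from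
     [d1 h1] to [d0 h0]. *)
  assert (Htr : forall (x : Ob A) (h k : C1 x b) (th : C2 x c),
            is2 th (comp1 d1 h) (comp1 d0 k) ->
            th = vcomp (hcomp (id2 d0) (hcomp (id2 l) th)) (hcomp rho (id2 h))).
  { intros x h k th Hth. rewrite <- Hud1, whisker_r_comp.
    exact (reflection_transpose Hu Hud0 _ _ _ _ Hth). }
  assert (Htr_inv : forall (x : Ob A) (h k : C1 x b) (be : C2 x b),
            is2 be (comp1 t h) k ->
            hcomp (id2 l) (vcomp (hcomp (id2 d0) be) (hcomp rho (id2 h))) = be).
  { intros x h k be Hbe. rewrite whisker_l_vcomp by ty.
    rewrite whisker_l_comp, Hl0, hcomp_idl, <- hcomp_assoc, Hlrho, hcomp_id2.
    apply vcomp_id_r; ty. }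
  assert (Hunit : forall (x : Ob A) (h : C1 x b) (be : C2 x b),
            is2 be (comp1 t h) h ->
            hcomp (id2 s0) (vcomp (hcomp (id2 d0) be) (hcomp rho (id2 h)))
            = vcomp be (hcomp eta (id2 h))).
  { intros x h be Hbe. rewrite whisker_l_vcomp by ty.
    rewrite whisker_l_comp, Hs00, hcomp_idl, <- hcomp_assoc, Hs0rho.
    reflexivity. }
  (* Both sides of the cocycle condition are brought to the form [(D0 d0 -) . (sg h)], the blank
     being [be . (m h)] here and [be . (t be)] in [Hmul02]. *)
  assert (Hmul1 : forall (x : Ob A) (h : C1 x b) (be : C2 x b),
            is2 be (comp1 t h) h ->
            hcomp (id2 D1) (vcomp (hcomp (id2 d0) be) (hcomp rho (id2 h)))
            = vcomp (hcomp (id2 (comp1 D0 d0)) (vcomp be (hcomp m (id2 h))))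
                (hcomp sg (id2 h))).
  { intros x h be Hbe. rewrite !whisker_l_vcomp by ty.
    rewrite whisker_l_comp, HD10, <- hcomp_assoc, HD1rho.
    rewrite whisker_r_vcomp by ty.
    rewrite hcomp_assoc. apply vcomp_assoc; ty. }
  assert (Hmul02 : forall (x : Ob A) (h : C1 x b) (be : C2 x b),
            is2 be (comp1 t h) h ->
            vcomp
              (hcomp (id2 D0) (vcomp (hcomp (id2 d0) be) (hcomp rho (id2 h))))
              (hcomp (id2 D2) (vcomp (hcomp (id2 d0) be) (hcomp rho (id2 h))))
            = vcomp (hcomp (id2 (comp1 D0 d0)) (vcomp be (hcomp (id2 t) be)))
                (hcomp sg (id2 h))).
  { intros x h be Hbe. unfold sg.
    rewrite !whisker_l_vcomp, whisker_r_vcomp by ty.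
    rewrite !whisker_l_comp, HP.
    rewrite !hcomp_assoc, hcomp_id2.
    (* Interchange slides [be] past [rho], which turns [d1 be] into [d0 t be]. *)
    assert (E : vcomp (hcomp (id2 D0) (hcomp rho (id2 h)))
                  (hcomp (id2 (comp1 D0 d1)) be)
                = vcomp (hcomp (id2 (comp1 (comp1 D0 d0) t)) be)
                    (hcomp (id2 D0) (hcomp rho (id2 (comp1 t h))))).
    { rewrite <- whisker_l_comp, <- whisker_l_vcomp by ty.
      rewrite (whisker_exchange rho _ _ be _ _ Hrho Hbe), whisker_l_vcomp by ty.
      rewrite whisker_l_comp, comp1_assoc. reflexivity. }
    rewrite <- (vcomp_assoc _ _ _ _
                 (hcomp (id2 D0) (hcomp rho (id2 h)))
                 (hcomp (id2 (comp1 D0 d0)) be)) by ty.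
    rewrite (vcomp_assoc _ _ _ _
                 (hcomp (id2 (comp1 D0 d1)) be)
                 (hcomp (id2 D0) (hcomp rho (id2 h)))) by ty.
    rewrite E. rewrite !vcomp_assoc by ty. reflexivity. }
  (* [L] sends [D0 d0] and [sg] to identities, so the common factor [sg h] can be cancelled. *)
  assert (HL : forall (x : Ob A) (h k : C1 x b) (be : C2 x b),
            is2 be (comp1 (comp1 t t) h) k ->
            hcomp (id2 L) (vcomp (hcomp (id2 (comp1 D0 d0)) be)
                             (hcomp sg (id2 h))) = be).
  { intros x h k be Hbe. rewrite whisker_l_vcomp by ty.
    rewrite whisker_l_comp, <- comp1_assoc, HL0, Hl0, hcomp_idl.
    rewrite <- hcomp_assoc, HLsg, hcomp_id2.
    apply vcomp_id_r; ty. }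
  assert (Hiff : forall (x : Ob A) (h : C1 x b) (be : C2 x b),
            is2 be (comp1 t h) h ->
            (IsDesc d0 d1 D0 D1 D2 s0 h
               (vcomp (hcomp (id2 d0) be) (hcomp rho (id2 h)))
             <-> IsAlg t m eta h be)).
  { intros x h be Hbe. unfold IsDesc, IsAlg.
    rewrite Hunit, Hmul1, Hmul02 by exact Hbe.
    split; intros (_ & H & H'); (split; [ty | split; [| exact H']]).
    - apply (f_equal (hcomp (id2 L))) in H.
      rewrite !(HL _ _ h) in H by ty. exact H.
    - rewrite H; reflexivity. }
  exists (fun x h be => hcomp (id2 l) be).
  repeat apply conj.
  - intros x h be H. assert (Hbe := proj1 H).
    apply Hiff; [ty|]. rewrite <- (Htr _ h h) by exact Hbe. exact H.
  - intros x h be H. assert (Hbe := proj1 H).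
    exists (vcomp (hcomp (id2 d0) be) (hcomp rho (id2 h))).
    split; [split|].
    + apply Hiff; assumption.
    + apply (Htr_inv _ _ h); exact Hbe.
    + intros be' [[Hbe' _] <-]. symmetry; apply (Htr _ h h); exact Hbe'.
  - intros x h1 be1 h0 be0 xi [H1 _] [H0 _].
    (* [l] carries the two sides of the descent equation to those of the algebra equation; [Htr]
       recovers each side from its image, which gives the converse. *)
    assert (E1 : is2 xi h1 h0 ->
              hcomp (id2 l) (vcomp be0 (hcomp (id2 d1) xi))
              = vcomp (hcomp (id2 l) be0) (hcomp (id2 t) xi)).
    { intros Hxi. rewrite whisker_l_vcomp, whisker_l_comp, Hl1 by ty.
      reflexivity. }
    assert (E2 : is2 xi h1 h0 ->
              hcomp (id2 l) (vcomp (hcomp (id2 d0) xi) be1)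
              = vcomp xi (hcomp (id2 l) be1)).
    { intros Hxi. rewrite whisker_l_vcomp, whisker_l_comp, Hl0, hcomp_idl by ty.
      reflexivity. }
    split; intros [Hxi H]; (split; [exact Hxi|]).
    + rewrite <- E1, <- E2, H by exact Hxi. reflexivity.
    + rewrite (Htr _ h1 h0 (vcomp be0 _)), (Htr _ h1 h0 (vcomp _ be1)) by ty.
      rewrite E1, E2, H by exact Hxi. reflexivity.
  - intros x g. rewrite <- hcomp_assoc, Hlal. reflexivity.
  - intros x x' u' h be _. symmetry; apply hcomp_assoc.
Qed.
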